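(* Let $p\in\mathbb{N}=\{0,1,2,\dots\}$, let $q$ be a super-critical offspring distribution ($\mu>1$) that admits a moment of order $p$, and suppose that $\mathfrak{a}>0$ (equivalently $q_0=0$), where $\mathfrak{a}=\min\{k\ge 0:\ q_k>0\}$. Then, for every $s\in(0,1)$, every $n\in\mathbb{N}$ and every $\Lambda_n\in\mathscr{F}_n$, $$\lim_{m\to+\infty}\frac{\mathbb{E}\left[H_p(Z_{m+n})s^{Z_{m+n}}\mathbf{1}_{\Lambda_n}\right]}{\mathbb{E}\left[H_p(Z_{m+n})s^{Z_{m+n}}\right]}=\begin{cases}\mathbb{E}\left[q_1^{-n}\,\mathbf{1}_{\{Z_n=1\}}\mathbf{1}_{\Lambda_n}\right] & \text{if }\mathfrak{a}=1,\\[4pt] \mathbb{E}\left[q_{\mathfrak{a}}^{-\frac{\mathfrak{a}^n-1}{\mathfrak{a}-1}}\,\mathbf{1}_{\{Z_n=\mathfrak{a}^n\}}\mathbf{1}_{\Lambda_n}\right] & \text{if }\mathfrak{a}\ge 2.\end{cases}$$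
   Context: $q=(q_n)_{n\in\mathbb{N}}$ is a probability distribution on the nonnegative integers with finite mean $\mu=\sum_n nq_n<+\infty$. $(Z_n)_{n\ge 0}$ is the Galton-Watson process with offspring distribution $q$ started from $Z_0=1$, and $(\mathscr{F}_n)_{n\ge 0}$ is its natural filtration. The polynomials $H_p$ are $H_0(x)=1$ and $H_p(x)=\frac{1}{p!}\prod_{k=0}^{p-1}(x-k)$ for $p\ge 1$. The quotient is considered for $m$ large. *)

(* Defs.v *)
From HB Require Import structures.
From mathcomp Require Import all_boot all_order all_algebra finmap.
From mathcomp Require Import all_classical all_reals all_analysis.

Set Implicit Arguments.
Unset Strict Implicit.
Unset Printing Implicit Defensive.

Import Order.TTheory GRing.Theory Num.Theory.
Import numFieldNormedType.Exports.

Local Open Scope classical_set_scope.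
Local Open Scope ring_scope.

Section OffspringLaw.
Context {R : realType}.
Implicit Types (q : R^nat) (p a : nat).

Definition probability_weights q : Prop :=
  (forall k, 0 <= q k) /\ series q @ \oo --> (1 : R).

Definition moment q p : \bar R :=
  (\sum_(0 <= k <oo) ((k%:R ^+ p * q k)%:E))%E.

Definition offspring_mean q : \bar R :=
  (\sum_(0 <= k <oo) ((k%:R * q k)%:E))%E.

Definition is_min_offspring q a : Prop :=
  0 < q a /\ (forall k, 0 < q k -> (a <= k)%N).

Definition hilbert_poly p : {poly R} :=
  (p`!%:R)^-1 *: \prod_(k < p) ('X - (k%:R)%:P).

Definition penalty p (s : R) (z : nat) : R := (hilbert_poly p).[z%:R] * s ^+ z.

End OffspringLaw.

Section GaltonWatson.
Context {d : measure_display} {T : measurableType d} {R : realType}.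

Definition mutually_independent {d' : measure_display} {T' : measurableType d'}
    (P : probability T R) (I : choiceType) (X : I -> {RV P >-> T'}) : Prop :=
  forall (J : {fset I}) (A : I -> set T'), (forall i, measurable (A i)) ->
    P (\bigcap_(i in [set` J]) (X i @^-1` A i)) =
    (\prod_(i <- J) P (X i @^-1` A i))%E.

(* [xi (n, i)] is the number of children of the [i]-th individual of
   generation [n]. *)
Definition galton_watson (P : probability T R) (q : R^nat)
    (Z : nat -> T -> nat) : Prop :=
  exists xi : nat * nat -> {RV P >-> nat},
    [/\ mutually_independent xi,
        (forall ni k, P (xi ni @^-1` [set k]) = (q k)%:E),
        (forall w, Z 0%N w = 1%N) &
        (forall n w, Z n.+1 w = (\sum_(i < Z n w) xi (n, i : nat) w)%N)].

Definition natural_filtration (Z : nat -> T -> nat) (n : nat) : set (set T) :=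
  <<s [set A | exists2 k, (k <= n)%N & exists B : set nat, A = Z k @^-1` B] >>.

End GaltonWatson.

(* Main.v *)
Require Import Defs.
From HB Require Import structures.
From mathcomp Require Import all_boot all_order all_algebra finmap.
From mathcomp Require Import all_classical all_reals all_analysis.
From mathcomp Require Import measurable_realfun ring lra.
Import Order.TTheory GRing.Theory Num.Theory.
Import numFieldNormedType.Exports.
Local Open Scope classical_set_scope.
Local Open Scope ring_scope.

(** Write [b = a ^ n], the smallest possible value of [Z_n], and let [u_j(m)] be
    the mean of [H_p(Z_m) s ^ Z_m] for a population started from [j] individuals.
    By the Markov property the numerator is the sum over [j >= b] of
    [P(L, Z_n = j) u_j(m)], and the denominator is the same sum with [L] the
    sure event. Both are governed by their first term, because [u_j(m) / u_b(m)]
    tends to [0] geometrically in [m], uniformly in [j > b]. The ratio therefore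
    tends to [P(L, Z_n = b) / P(Z_n = b)], and [Z_n = b] happens exactly when each
    of the [1 + a + ... + a ^ (n - 1)] individuals of the first [n] generations
    has [a] children, whence the power of [q a] in the limit.

    The comparison of [u_j] with [u_b] ([gw_bin_weight_ratio]) rests on the
    branching property. On integers [H_p] is a binomial coefficient, so the
    Vandermonde identity splits [H_p(X + Y) s ^ (X + Y)], where [X] and [Y] are
    the progenies of [b] and of [j - b] ancestors, into products of a weight of
    order [i <= p] of [X] and a weight of order [p - i] of [Y].
    - The weights of [Y] tend to [0] ([gw_bin_weight_le]): the binomial
      coefficient is absorbed by replacing [s] by some [r] in [(s, 1)], and the
      mean of [r ^ Y] decreases by a constant factor at each generation, since
      the generating function of [q] lies below the diagonal.
    - The weights of order [i <= p] of [X] are bounded by a constant times that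
      of order [p] ([gw_bin_weight_dom]): this is clear as long as [X >= p], and
      the event [X < p] is handled by the monotonicity of the population and by
      the possibility of growing beyond [p] within [p] generations.

    All means are computed with the transition operator of the chain, acting on
    nonnegative functions on the integers. The link with the process is
    [integral_gw]; it needs that events determined by [Z_0, ..., Z_n] are
    independent of the litters of the later generations
    ([determined_by_indep]). *)

(** * The transition operator of the Galton-Watson chain *)

Lemma nneseriesZl_ereal (R : realType) (c : \bar R) (f : nat -> \bar R) :
  (0 <= c)%E -> (forall k, 0 <= f k)%E ->
  (\sum_(0 <= k <oo) c * f k = c * \sum_(0 <= k <oo) f k)%E.
Proof.
move=> c0 f0; case: c c0 => [c| |] // c0; first by rewrite nneseriesZl.
have [[k fk]|fN0] := pselect (exists k, f k != 0%E).
  have fk_gt0 : (0 < f k)%E by rewrite lt0e fk f0.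
  rewrite gt0_mulye; last first.
    rewrite (nneseriesD1 (n := k))//; apply: (lt_le_trans fk_gt0).
    by apply: leeDl; exact: nneseries_ge0.
  apply: (nneseries_pinfty (k := k)) => //; last by rewrite gt0_mulye.
  by move=> i _; exact: mule_ge0.
have f_eq0 k : f k = 0%E.
  by apply/eqP/negP => /negP fk; apply: fN0; exists k.
by rewrite !eseries0 ?mule0// => k _ _; rewrite f_eq0 ?mule0.
Qed.

Section Branching.
Context {R : realType} (q : R^nat) (a : nat).
Hypothesis q_ge0 : forall k, 0 <= q k.
Hypothesis q_sum : (\sum_(0 <= k <oo) (q k)%:E = 1)%E.
Hypothesis q_min : forall k, 0 < q k -> (a <= k)%N.
Implicit Types (h g : nat -> \bar R) (j k l m n : nat).

Local Open Scope ereal_scope.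

(** The mean of [h] at the total offspring of [j] individuals. Working with
    extended-real functions makes every sum of nonnegative terms meaningful, so
    that summability never has to be discussed. *)
Fixpoint litter_mean j h : \bar R :=
  if j is i.+1 then
    \sum_(0 <= k <oo) (q k)%:E * litter_mean i (fun x => h (k + x)%N)
  else h 0%N.

(** The mean of [h(Z_m)] when the population starts with [j] individuals. *)
Definition gw_mean m h j : \bar R :=
  iter m (fun g i => litter_mean i g) h j.

Lemma litter_mean_ge0 j h : (forall k, 0 <= h k) -> 0 <= litter_mean j h.
Proof.
elim: j h => [|j IH] h h0 //=; apply: nneseries_ge0 => k _ _.
by apply: mule_ge0; [rewrite lee_fin | apply: IH].
Qed.

(** [j] individuals have at least [a * j] children, so only the values of [h]
    from there on matter. *)
Lemma le_litter_mean j h g : (forall k, 0 <= h k) ->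
  (forall k, (a * j <= k)%N -> h k <= g k) ->
  litter_mean j h <= litter_mean j g.
Proof.
elim: j h g => [|j IH] h g h0 hg /=; first by apply: hg; rewrite muln0.
apply: lee_nneseries => [k _ _|k _].
  by apply: mule_ge0; [rewrite lee_fin | exact: litter_mean_ge0].
have [qk|] := ltP 0%R (q k); last first.
  by move=> qk; have -> : q k = 0%R; [apply/le_anti; rewrite qk q_ge0 | rewrite !mul0e].
apply: lee_wpmul2l; first by rewrite lee_fin.
apply: IH => // x ajx; apply: hg; rewrite mulnS; apply: leq_add => //; exact: q_min.
Qed.

Lemma litter_meanZ j h (c : \bar R) : 0 <= c -> (forall k, 0 <= h k) ->
  litter_mean j (fun k => c * h k) = c * litter_mean j h.
Proof.
move=> c0; elim: j h => [|j IH] h h0 //=; rewrite -nneseriesZl_ereal//.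
  by apply: eq_eseriesr => k _; rewrite IH// muleCA.
by move=> k; apply: mule_ge0; [rewrite lee_fin | exact: litter_mean_ge0].
Qed.

Lemma litter_mean_sum (I : Type) (r : seq I) j (h : I -> nat -> \bar R) :
  (forall i k, 0 <= h i k) ->
  litter_mean j (fun k => \sum_(i <- r) h i k) = \sum_(i <- r) litter_mean j (h i).
Proof.
elim: j h => [|j IH] h h0 //=; rewrite -nneseries_sum//; last first.
  by move=> i k _; apply: mule_ge0; [rewrite lee_fin | exact: litter_mean_ge0].
apply: eq_eseriesr => k _; rewrite IH// ge0_sume_distrr// => i _.
exact: litter_mean_ge0.
Qed.

(** The branching property: the litters of two disjoint groups are independent. *)
Lemma litter_meanD j l h : litter_mean (j + l) h =
  litter_mean j (fun x => litter_mean l (fun y => h (x + y)%N)).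
Proof.
elim: j h => [|j IH] h //=; apply: eq_eseriesr => k _; rewrite IH.
congr (_ * litter_mean j _); apply: funext => x; congr litter_mean.
by apply: funext => y; rewrite addnA.
Qed.

Lemma litter_mean_cst j (c : \bar R) : 0 <= c -> litter_mean j (fun=> c) = c.
Proof.
move=> c0; elim: j => [|j IH] //=; rewrite IH.
under eq_eseriesr do rewrite muleC.
by rewrite nneseriesZl_ereal ?q_sum ?mule1// => k; rewrite lee_fin.
Qed.

(** When [h] vanishes above the smallest possible size [a * j] of the litter,
    the only contribution is that of each individual having [a] children. *)
Lemma litter_mean_min j h : (forall k, 0 <= h k) ->
  (forall k, (a * j < k)%N -> h k = 0) ->
  litter_mean j h = (q a ^+ j)%:E * h (a * j)%N.
Proof.
elim: j h => [|j IH] h h0 hs /=; first by rewrite expr0 mul1e muln0.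
rewrite (nneseriesD1 (n := a))//; last first.
  by move=> k _; apply: mule_ge0; [rewrite lee_fin | exact: litter_mean_ge0].
rewrite eseries0 => [|k _ /= ka].
  rewrite adde0 IH => [|//|k ajk]; last by apply: hs; rewrite mulnS ltn_add2l.
  by rewrite exprS EFinM muleA mulnS.
have [qk|] := ltP 0%R (q k); last first.
  by move=> qk; have -> : q k = 0%R; [apply/le_anti; rewrite qk q_ge0 | rewrite mul0e].
have {}ka : (a < k)%N by rewrite ltn_neqAle eq_sym ka q_min.
suff -> : litter_mean j (fun x => h (k + x)%N) = 0 by rewrite mule0.
apply/le_anti; rewrite litter_mean_ge0// andbT.
rewrite -[leRHS](litter_mean_cst j _ (lexx 0)); apply: le_litter_mean => // x ajx.
by rewrite hs// mulnS -ltnS -addSn ltnS leq_add.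
Qed.

Lemma litter_mean_path b j h : (forall k, 0 <= h k) ->
  (q b ^+ j)%:E * h (b * j)%N <= litter_mean j h.
Proof.
elim: j h => [|j IH] h h0 /=; first by rewrite expr0 mul1e muln0.
rewrite (nneseriesD1 (n := b))//; last first.
  by move=> k _; apply: mule_ge0; [rewrite lee_fin | exact: litter_mean_ge0].
rewrite -[leLHS]adde0; apply: leeD; last first.
  apply: nneseries_ge0 => k _ _.
  by apply: mule_ge0; [rewrite lee_fin | exact: litter_mean_ge0].
rewrite exprS EFinM -muleA mulnS; apply: lee_wpmul2l; first by rewrite lee_fin.
exact: IH.
Qed.

Lemma gw_meanS m h : gw_mean m.+1 h = fun j => litter_mean j (gw_mean m h).
Proof. by []. Qed.

Lemma gw_meanDn m n h : gw_mean (m + n) h = gw_mean m (gw_mean n h).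
Proof. by rewrite /gw_mean iterD. Qed.

Lemma gw_mean_ge0 m h j : (forall k, 0 <= h k) -> 0 <= gw_mean m h j.
Proof.
by move=> h0; elim: m j => [|m IH] j //; rewrite gw_meanS; exact: litter_mean_ge0.
Qed.

Lemma le_gw_mean m h g j : (forall k, 0 <= h k) ->
  (forall k, (a ^ m * j <= k)%N -> h k <= g k) ->
  gw_mean m h j <= gw_mean m g j.
Proof.
move=> h0; elim: m j => [|m IH] j hg; first by apply: hg; rewrite expn0 mul1n.
rewrite gw_meanS; apply: le_litter_mean => [k|k ajk]; first exact: gw_mean_ge0.
apply: IH => x ax; apply: hg; apply: leq_trans ax.
by rewrite expnSr -mulnA leq_mul2l ajk orbT.
Qed.

Lemma gw_meanZ m h c j : 0 <= c -> (forall k, 0 <= h k) ->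
  gw_mean m (fun k => c * h k) j = c * gw_mean m h j.
Proof.
move=> c0 h0; elim: m j => [//|m IH] j.
rewrite !gw_meanS -litter_meanZ// => [|k]; last exact: gw_mean_ge0.
by congr litter_mean; apply: funext.
Qed.

Lemma gw_mean_cst m (c : \bar R) j : 0 <= c -> gw_mean m (fun=> c) j = c.
Proof.
move=> c0; elim: m j => [//|m IH] j; rewrite gw_meanS.
by rewrite -[RHS](litter_mean_cst j _ c0); congr litter_mean; apply: funext.
Qed.

Lemma gw_mean_add m h g j : (forall k, 0 <= h k) -> (forall k, 0 <= g k) ->
  gw_mean m (fun k => h k + g k) j = gw_mean m h j + gw_mean m g j.
Proof.
move=> h0 g0; elim: m j => [//|m IH] j; rewrite !gw_meanS.
have := @litter_mean_sum _ [:: true; false] j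
  (fun b => if b then gw_mean m h else gw_mean m g).
rewrite !big_cons big_nil adde0 => <-; last by case=> k; exact: gw_mean_ge0.
by congr litter_mean; apply: funext => k; rewrite IH !big_cons big_nil adde0.
Qed.

(** The branching property over [m] generations, for a function that splits
    along sums into products: this is the form in which the binomial coefficient
    of a sum enters. *)
Lemma gw_mean_branching (I : Type) (r : seq I) (g g' : I -> nat -> \bar R) h :
  (forall i k, 0 <= g i k) -> (forall i k, 0 <= g' i k) ->
  (forall x y, h (x + y)%N = \sum_(i <- r) g i x * g' i y) ->
  forall m j l, gw_mean m h (j + l) =
    \sum_(i <- r) gw_mean m (g i) j * gw_mean m (g' i) l.
Proof.
move=> g0 g'0 hgg'; elim=> [|m IH] j l; first exact: hgg'.
rewrite gw_meanS litter_meanD.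
transitivity (litter_mean j (fun x => \sum_(i <- r)
    gw_mean m.+1 (g' i) l * gw_mean m (g i) x)).
  congr litter_mean; apply: funext => x.
  transitivity (litter_mean l (fun y => \sum_(i <- r)
      gw_mean m (g i) x * gw_mean m (g' i) y)).
    by congr litter_mean; apply: funext => y; exact: IH.
  rewrite litter_mean_sum => [|i y]; last by apply: mule_ge0; exact: gw_mean_ge0.
  apply: eq_bigr => i _; rewrite litter_meanZ//; first by rewrite muleC.
    exact: gw_mean_ge0.
  by move=> k; exact: gw_mean_ge0.
rewrite litter_mean_sum => [|i x]; last by apply: mule_ge0; exact: gw_mean_ge0.
apply: eq_bigr => i _; rewrite litter_meanZ//; first by rewrite muleC.
  exact: gw_mean_ge0.
by move=> k; exact: gw_mean_ge0.
Qed.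

(** Along the slowest genealogy, in which every individual has [a] children, the
    population of generation [n] descends from [j * (1 + a + ... + a ^ (n - 1))]
    individuals. *)
Lemma gw_mean_min n h j : (forall k, 0 <= h k) ->
  (forall k, (a ^ n * j < k)%N -> h k = 0) -> (0 < a)%N ->
  gw_mean n h j = (q a ^+ (j * \sum_(i < n) a ^ i)%N)%:E * h (a ^ n * j)%N.
Proof.
move=> h0 + a0; elim: n j => [|n IH] j hs.
  by rewrite big_ord0 muln0 expr0 mul1e expn0 mul1n.
rewrite gw_meanS litter_mean_min => [|k|k ajk]; first last.
- apply/le_anti; rewrite gw_mean_ge0// andbT.
  rewrite -[leRHS](gw_mean_cst n _ k (lexx 0)); apply: le_gw_mean => // x akx.
  rewrite hs//; apply: leq_trans akx.
  by rewrite expnSr -mulnA ltn_pmul2l// expn_gt0 a0.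
- exact: gw_mean_ge0.
rewrite IH => [|k ajk]; last by apply: hs; rewrite expnSr -mulnA.
rewrite muleA -EFinM -exprD mulnA -expnSr; congr ((_ ^+ _)%:E * _).
rewrite big_ord_recl /= expn0 mulnDr muln1 -mulnA mulnCA; congr (_ + _ * _)%N.
by rewrite big_distrr; apply: eq_bigr => i _; rewrite /= /bump leq0n add1n expnS.
Qed.

Lemma gw_mean_path b m j h : (forall k, 0 <= h k) -> (0 < q b)%R ->
  0 < h (b ^ m * j)%N -> 0 < gw_mean m h j.
Proof.
move=> h0 qb; elim: m j => [|m IH] j hj; first by move: hj; rewrite expn0 mul1n.
rewrite gw_meanS; apply: lt_le_trans (litter_mean_path b j _ _); last first.
  by move=> k; exact: gw_mean_ge0.
apply: mule_gt0; first by rewrite lte_fin exprn_gt0.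
by apply: IH; rewrite mulnA -expnSr.
Qed.

(** * Comparison of the penalties for different initial populations *)

Section Penalty.
Context (p : nat) (s : R) (b0 : nat).
Hypothesis a_gt0 : (0 < a)%N.
Hypothesis s01 : (0 < s < 1)%R.
Hypothesis b0_gt1 : (1 < b0)%N.
Hypothesis q_b0 : (0 < q b0)%R.

Definition bin_weight i k : \bar R := ('C(k, i)%:R * s ^+ k)%:E.

Lemma bin_weight_ge0 i k : 0 <= bin_weight i k.
Proof. by case/andP: s01 => s0 _; rewrite lee_fin mulr_ge0// exprn_ge0// ltW. Qed.

Let bw0 i := bin_weight_ge0 i.

Lemma bin_weightD x y : bin_weight p (x + y)%N =
  \sum_(i < p.+1) bin_weight i x * bin_weight (p - i) y.
Proof.
rewrite /bin_weight; under eq_bigr do rewrite -EFinM mulrACA -exprD.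
rewrite sumEFin -mulr_suml; congr (_ * _)%:E.
by rewrite -binomial.Vandermonde natr_sum; apply: eq_bigr => i _; rewrite natrM.
Qed.

Lemma bin_expr_le (t : R) i y : (0 <= t)%R ->
  ('C(y, i)%:R * t ^+ i <= (1 + t) ^+ y)%R.
Proof.
move=> t0; have t10 : (0 <= 1 + t)%R by rewrite addr_ge0.
elim: y i => [|y IH] [|i]; rewrite ?bin0 ?mul1r ?expr0 ?bin0n ?mul0r ?ler01//.
  by rewrite exprn_ege1// lerDl.
rewrite binS natrD mulrDl [in leRHS]exprS mulrDl mul1r lerD//.
by rewrite exprS mulrCA ler_wpM2l.
Qed.

(** The slack in [s < (1 + s) / 2 < 1] absorbs the polynomial growth of the
    binomial coefficient; [slack] solves [s * (1 + slack) = (1 + s) / 2]. *)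
Let slack : R := ((1 - s) / (2 * s))%R.
Let r : R := ((1 + s) / 2)%R.

Let slack_gt0 : (0 < slack)%R.
Proof. by case/andP: s01 => s0 s1; rewrite divr_gt0 ?subr_gt0// mulr_gt0. Qed.

Let r01 : (0 < r < 1)%R.
Proof. by case/andP: s01 => s0 s1; rewrite /r; apply/andP; split; lra. Qed.

Lemma bin_weight_le i y :
  bin_weight i y <= (slack ^- i)%:E * (r ^+ y)%:E.
Proof.
case/andP: s01 => s0 s1; rewrite -EFinM lee_fin ler_pdivlMl ?exprn_gt0//.
have -> : r = ((1 + slack) * s)%R by rewrite /r /slack; field; rewrite gt_eqF.
rewrite [in leRHS]exprMn mulrCA mulrA; apply: ler_wpM2r; first by rewrite exprn_ge0// ltW.
exact/bin_expr_le/ltW.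
Qed.

Let rate : R := (1 - q b0 * (1 - r))%R.

Lemma q_le1 k : (q k <= 1)%R.
Proof.
rewrite -lee_fin -q_sum (nneseriesD1 (n := k))// => [|i _]; last by rewrite lee_fin.
by apply: leeDl; apply: nneseries_ge0 => i _ _; rewrite lee_fin.
Qed.

Let rate01 : (0 <= rate < 1)%R.
Proof.
case/andP: r01 => r0 r1; rewrite /rate; apply/andP; split; last first.
  by rewrite ltrBlDr ltrDl mulr_gt0// subr_gt0.
rewrite subr_ge0 -[leRHS]mul1r; apply: ler_pM; rewrite ?subr_ge0 ?q_le1//; lra.
Qed.

Let expr_r_ge0 k : 0 <= (r ^+ k)%:E.
Proof. by case/andP: r01 => r0 _; rewrite lee_fin exprn_ge0// ltW. Qed.

(** The generating function lies strictly below the diagonal, by a factor that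
    the event of having [b0 >= 2] children provides. *)
Lemma offspring_gf_le : \sum_(0 <= k <oo) (q k)%:E * (r ^+ k)%:E <= (rate * r)%:E.
Proof.
case/andP: (r01) => r0 r1.
have q_r : \sum_(0 <= k <oo) (q k)%:E * r%:E = r%:E.
  under eq_eseriesr do rewrite muleC.
  by rewrite nneseriesZl// ?q_sum ?mule1// => k _; rewrite lee_fin.
have qr0 k : 0 <= (q k)%:E * r%:E by rewrite mule_ge0// lee_fin// ltW.
have qrk0 k : 0 <= (q k)%:E * (r ^+ k)%:E by rewrite mule_ge0// lee_fin.
have tailE : \sum_(0 <= k <oo | k != b0) (q k)%:E * r%:E = (r - q b0 * r)%:E.
  move: q_r; rewrite (nneseriesD1 (n := b0))//= -EFinM.
  move=> /(congr1 (fun x => x - (q b0 * r)%:E)).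
  by rewrite addeAC subee// add0e EFinB.
rewrite (nneseriesD1 (n := b0))//.
have -> : (rate * r)%:E = (q b0 * r ^+ 2)%:E + (r - q b0 * r)%:E.
  by rewrite -EFinD; congr EFin; rewrite /rate; ring.
apply: leeD.
  rewrite -EFinM lee_fin ler_wpM2l//.
  by rewrite ler_wiXn2l// ltW.
rewrite -tailE; apply: lee_nneseries => // k _; rewrite -!EFinM lee_fin.
have [qk|] := ltP 0%R (q k); last first.
  by move=> qk; have -> : q k = 0%R; [apply/le_anti; rewrite qk q_ge0 | rewrite !mul0r].
rewrite ler_wpM2l// -[leRHS]expr1 ler_wiXn2l// ?(ltW r0) ?(ltW r1)//.
exact: leq_trans (q_min _ qk).
Qed.

Lemma litter_mean_expr j : (0 < j)%N ->
  litter_mean j (fun k => (r ^+ k)%:E) <= rate%:E * (r ^+ j)%:E.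
Proof.
case/andP: (r01) => r0 r1; case/andP: (rate01) => rate0 rate1.
have step i : litter_mean i.+1 (fun k => (r ^+ k)%:E) <=
    (rate * r)%:E * litter_mean i (fun k => (r ^+ k)%:E).
  have L0 : 0 <= litter_mean i (fun k => (r ^+ k)%:E) by exact: litter_mean_ge0.
  rewrite /=; apply: le_trans (lee_wpmul2r L0 offspring_gf_le).
  rewrite muleC -nneseriesZl_ereal//; last by move=> k; rewrite mule_ge0// lee_fin.
  apply: lee_nneseries => [k _ _|k _].
    by rewrite mule_ge0 ?lee_fin//; exact: litter_mean_ge0.
  under [X in litter_mean _ X]funext do rewrite exprD EFinM.
  by rewrite litter_meanZ// muleA muleC.
have weak i : litter_mean i (fun k => (r ^+ k)%:E) <= (r ^+ i)%:E.
  elim: i => [|i IH]; first by rewrite /= expr0.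
  apply: (le_trans (step i)); rewrite [in leRHS]exprS [in leRHS]EFinM; apply: lee_pmul => //.
  - by rewrite lee_fin mulr_ge0// ltW.
  - exact: litter_mean_ge0.
  - by rewrite lee_fin ler_piMl// ltW.
case: j => // j _; apply: (le_trans (step j)).
rewrite exprS [in leRHS]EFinM muleA -EFinM (EFinM (rate * r)%R); apply: lee_wpmul2l => //.
by rewrite lee_fin mulr_ge0// ltW.
Qed.

Lemma gw_mean_expr m j : (0 < j)%N ->
  gw_mean m (fun k => (r ^+ k)%:E) j <= (rate ^+ m)%:E.
Proof.
case/andP: (r01) => r0 r1; case/andP: (rate01) => rate0 rate1 j0.
suff H : gw_mean m (fun k => (r ^+ k)%:E) j <= (rate ^+ m)%:E * (r ^+ j)%:E.
  apply: (le_trans H); rewrite -EFinM lee_fin ler_piMr ?exprn_ge0//.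
  by rewrite exprn_ile1// ltW.
elim: m j j0 => [|m IH] j j0; first by rewrite expr0 mul1e.
have ratem : 0 <= (rate ^+ m)%:E by rewrite lee_fin exprn_ge0.
rewrite gw_meanS exprSr EFinM -muleA.
apply: le_trans (lee_wpmul2l ratem (litter_mean_expr _ j0)).
rewrite -litter_meanZ//; apply: le_litter_mean => [k|k ajk].
  exact: gw_mean_ge0.
by apply: IH; apply: leq_trans ajk; rewrite muln_gt0 a_gt0.
Qed.

Lemma gw_bin_weight_le i m j : (0 < j)%N ->
  gw_mean m (bin_weight i) j <= (slack ^- i * rate ^+ m)%:E.
Proof.
move=> j0; have c0 : 0 <= (slack ^- i)%:E by rewrite lee_fin invr_ge0 exprn_ge0// ltW.
rewrite EFinM; apply: le_trans (lee_wpmul2l c0 (gw_mean_expr m j j0)).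
by rewrite -gw_meanZ//; apply: le_gw_mean => // k _; exact: bin_weight_le.
Qed.

Lemma gw_bin_weight_fin i m j : (0 < j)%N ->
  gw_mean m (bin_weight i) j \is a fin_num.
Proof.
move=> j0; rewrite ge0_fin_numE ?gw_mean_ge0//.
by rewrite (le_lt_trans (gw_bin_weight_le i m j j0))// ltry.
Qed.

(** Growing at least like [b0 ^ m >= 2 ^ m], the population exceeds [p] after
    [p] generations with positive probability. *)
Lemma gw_bin_weight_gt0 m j : (p <= m)%N -> (0 < j)%N ->
  0 < gw_mean m (bin_weight p) j.
Proof.
move=> pm j0; apply: (gw_mean_path b0) => //.
case/andP: s01 => sgt0 _; rewrite lte_fin mulr_gt0 ?exprn_gt0// ltr0n bin_gt0.
apply: leq_trans (leq_pmulr _ j0); apply: (leq_trans pm).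
exact/ltnW/ltn_expl.
Qed.

(** What a weight of order below [p] can charge while the weight of order [p]
    vanishes. *)
Let small k : \bar R := if (k < p)%N then (s ^+ k)%:E else 0.

Let small_ge0 k : 0 <= small k.
Proof.
by case/andP: s01 => s0 _; rewrite /small; case: ifP => // _; rewrite lee_fin exprn_ge0// ltW.
Qed.

(** [small] is nonincreasing and the population never decreases. *)
Lemma gw_small_le m j : gw_mean m small j <= small j.
Proof.
case/andP: s01 => s0 s1.
have step i : litter_mean i small <= small i.
  rewrite -[leRHS](litter_mean_cst i _ (small_ge0 i)).
  apply: le_litter_mean => // k aik.
  have ik : (i <= k)%N by apply: leq_trans aik; exact: leq_pmull.
  rewrite {1}/small; case: ifP => [kp|//].
  by rewrite /small (leq_ltn_trans ik kp) lee_fin ler_wiXn2l// ltW.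
elim: m j => [//|m IH] j; rewrite gw_meanS; apply: le_trans (step j).
by apply: le_litter_mean => // k; exact: gw_mean_ge0.
Qed.

Lemma small_le_gw : exists2 C : R, (0 <= C)%R &
  forall j, (0 < j)%N -> small j <= C%:E * gw_mean p (bin_weight p) j.
Proof.
pose f j := fine (gw_mean p (bin_weight p) j).
have f0 j : (0 <= f j)%R by rewrite fine_ge0// gw_mean_ge0.
exists (\sum_(j < p) (f j)^-1)%R; first by apply: sumr_ge0 => j _; rewrite invr_ge0.
move=> j j0; have fjE : gw_mean p (bin_weight p) j = (f j)%:E.
  by rewrite fineK// gw_bin_weight_fin.
have fj : (0 < f j)%R by rewrite -lte_fin -fjE gw_bin_weight_gt0.
rewrite /small; case: ifP => [jp|_]; rewrite fjE -EFinM lee_fin; last first.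
  by rewrite mulr_ge0// sumr_ge0// => i _; rewrite invr_ge0.
case/andP: s01 => s0 s1.
apply: (@le_trans _ _ 1%R); first by rewrite exprn_ile1// ltW.
rewrite -(mulVf (lt0r_neq0 fj)) ler_wpM2r//.
rewrite (bigD1 (Ordinal jp))//= lerDl sumr_ge0// => i _.
by rewrite invr_ge0.
Qed.

Lemma bin_weight_le_small i k : (i <= p)%N ->
  bin_weight i k <= (p`!%:R)%:E * (bin_weight p k + small k).
Proof.
move=> ip; case/andP: s01 => s0 s1; have sk : (0 <= s ^+ k)%R by rewrite exprn_ge0// ltW.
rewrite /small; case: ltnP => [kp|pk].
  rewrite /bin_weight (bin_small kp) mul0r add0e -EFinM lee_fin ler_wpM2r//.
  rewrite ler_nat; apply: leq_trans (leq_fact (ltnW kp)).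
  have [ik|ki] := leqP i k; last by rewrite bin_small.
  by rewrite -(bin_fact ik) leq_pmulr// muln_gt0 !fact_gt0.
rewrite adde0 -EFinM lee_fin mulrA ler_wpM2r// -natrM ler_nat.
rewrite mulnC bin_ffact.
apply: (@leq_trans (k ^_ i)); first by rewrite -bin_ffact leq_pmulr// fact_gt0.
rewrite -(leq_pmul2r (fact_gt0 (k - i))) (ffact_fact (leq_trans ip pk)).
by rewrite -(ffact_fact pk) leq_mul2l leq_fact ?orbT// leq_sub2l.
Qed.

(** The weights of order [i <= p] are dominated by those of order [p] uniformly
    in time: where they are not, the population is smaller than [p]; it was then
    smaller than [p] already [p] generations ago, from where it could have
    grown beyond [p] at a bounded cost. *)
Lemma gw_bin_weight_dom : exists2 C : R, (0 <= C)%R &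
  forall i m j, (i <= p)%N -> (p <= m)%N -> (0 < j)%N ->
    gw_mean m (bin_weight i) j <= C%:E * gw_mean m (bin_weight p) j.
Proof.
have [C C0 hC] := small_le_gw.
exists (p`!%:R * (1 + C))%R; first by rewrite mulr_ge0// addr_ge0.
move=> i m j ip pm j0; rewrite -(subnK pm); set l := (m - p)%N.
have ge0_p k : 0 <= gw_mean p (bin_weight p) k by exact: gw_mean_ge0.
have small_dom : gw_mean (l + p) small j <= C%:E * gw_mean (l + p) (bin_weight p) j.
  rewrite !gw_meanDn -gw_meanZ//; apply: le_gw_mean => [k|k ajk].
    exact: gw_mean_ge0.
  apply: (le_trans (gw_small_le _ _)); apply: hC; apply: leq_trans ajk.
  by rewrite muln_gt0 expn_gt0 a_gt0.
have ge0_sum k : 0 <= bin_weight p k + small k by rewrite adde_ge0.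
apply: (@le_trans _ _ (gw_mean (l + p)
    (fun k => (p`!%:R)%:E * (bin_weight p k + small k)) j)).
  by apply: le_gw_mean => // k _; exact: bin_weight_le_small.
rewrite gw_meanZ// EFinM -muleA gw_mean_add//; apply: lee_wpmul2l => //.
by rewrite EFinD ge0_muleDl ?lee_fin// mul1e leeD2l.
Qed.

(** One extra ancestor costs a geometric factor: by the branching property it
    contributes a weight that its never dying progeny drives to [0], and the
    other ancestors are left with a weight of order at most [p]. *)
Lemma gw_bin_weight_ratio : exists C rho : R,
  [/\ (0 <= C)%R, (0 <= rho < 1)%R &
    forall m b j, (p <= m)%N -> (0 < b)%N -> (b < j)%N ->
    gw_mean m (bin_weight p) j <= (C * rho ^+ m)%:E * gw_mean m (bin_weight p) b].
Proof.
have [C C0 hC] := gw_bin_weight_dom.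
have sl0 i : (0 <= slack ^- i)%R by rewrite invr_ge0 exprn_ge0// ltW.
case/andP: (rate01) => rate0 rate1.
exists (\sum_(i < p.+1) C * slack ^- (p - i))%R, rate; split => //.
  by apply: sumr_ge0 => i _; rewrite mulr_ge0.
move=> m b j pm b0' bj; rewrite -(subnKC (ltnW bj)).
rewrite (gw_mean_branching _ _ (fun i : 'I_p.+1 => bin_weight i)
  (fun i : 'I_p.+1 => bin_weight (p - i)) _ _ _ bin_weightD)//.
rewrite mulr_suml -sumEFin ge0_sume_distrl; last first.
  by move=> i _; rewrite lee_fin !mulr_ge0// exprn_ge0.
apply: lee_sum => i _.
have -> : (C * slack ^- (p - i) * rate ^+ m)%:E * gw_mean m (bin_weight p) b =
    C%:E * gw_mean m (bin_weight p) b * (slack ^- (p - i) * rate ^+ m)%:E.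
  by rewrite -mulrA EFinM muleAC.
apply: lee_pmul; rewrite ?gw_mean_ge0//.
  by apply: hC => //; rewrite -ltnS.
by apply: gw_bin_weight_le; rewrite subn_gt0.
Qed.

End Penalty.

End Branching.

(** * The Markov property of the Galton-Watson process *)

Section MarkovProperty.
Context {d : measure_display} {T : measurableType d} {R : realType}.
Context (P : probability T R) (q : R^nat) (Z : nat -> T -> nat).
Context (xi : nat * nat -> {RV P >-> nat}).
Hypothesis xi_indep : mutually_independent xi.
Hypothesis xi_law : forall ni k, P (xi ni @^-1` [set k]) = (q k)%:E.
Hypothesis Z0 : forall w, Z 0%N w = 1%N.
Hypothesis ZS : forall n w, Z n.+1 w = (\sum_(i < Z n w) xi (n, i : nat) w)%N.
Implicit Types (S : set (nat * nat)) (A L : set T) (n j k : nat).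

Local Open Scope ereal_scope.

(** Independence from the family [xi i], [i] in [S], is tracked event by event: it
    is stable under countable disjoint unions and, once [i] is removed from [S],
    under intersection with an event of [xi i], which is all that revealing the
    litters one individual at a time requires. *)
Definition indep_of S A : Prop := measurable A /\
  forall (J : {fset nat * nat}) (B : nat * nat -> set nat), [set` J] `<=` S ->
    P (A `&` \bigcap_(i in [set` J]) (xi i @^-1` B i)) =
    P A * \prod_(i <- J) P (xi i @^-1` B i).

Lemma measurable_xi_preimage i (B : set nat) : measurable (xi i @^-1` B).
Proof. by rewrite -[X in measurable X]setTI; exact: measurable_funP. Qed.

Lemma measurable_bigcap_xi (J : {fset nat * nat}) (B : nat * nat -> set nat) :
  measurable (\bigcap_(i in [set` J]) (xi i @^-1` B i)).
Proof.
rewrite bigcap_fset; apply: bigsetI_measurable => i _.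
exact: measurable_xi_preimage.
Qed.

Lemma indep_ofS S S' A : S' `<=` S -> indep_of S A -> indep_of S' A.
Proof. by move=> SS' [mA hA]; split => // J B JS'; apply: hA => i /JS'/SS'. Qed.

Lemma indep_of0 S : indep_of S set0.
Proof. by split => // J B _; rewrite set0I !measure0 mul0e. Qed.

Lemma indep_ofT S : indep_of S setT.
Proof.
by split => // J B _; rewrite setTI probability_setT mul1e; exact: xi_indep.
Qed.

Lemma indep_of_xiM S A i (B : set nat) : indep_of S A -> S i ->
  P (A `&` xi i @^-1` B) = P A * P (xi i @^-1` B).
Proof.
move=> [mA hA] Si; have := hA [fset i]%fset (fun=> B).
rewrite big_seq_fset1 bigcap_fset big_seq_fset1; apply.
by move=> x /=; rewrite inE => /eqP ->.
Qed.

Lemma indep_of_xi S A i (B : set nat) : indep_of S A -> S i ->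
  indep_of (S `\ i) (A `&` xi i @^-1` B).
Proof.
move=> hA Si; have [mA PA] := hA.
split => [|J C JS]; first by apply: measurableI => //; exact: measurable_xi_preimage.
have iJ : i \notin J by apply/negP => /JS [_ /=]; apply.
pose C' x := if x == i then B else C x.
have C'J x : x \in J -> C' x = C x.
  by rewrite /C'; case: eqP => // -> ; rewrite (negbTE iJ).
have := PA (i |` J)%fset C'; rewrite bigcap_fsetU1 big_fsetU1//=.
have -> : \bigcap_(x in [set` J]) (xi x @^-1` C' x) =
          \bigcap_(x in [set` J]) (xi x @^-1` C x).
  by apply: eq_bigcapr => x xJ; rewrite C'J.
rewrite [X in P A * (_ * X)](_ : _ = \prod_(x <- J) P (xi x @^-1` C x)); last first.
  by rewrite big_seq [RHS]big_seq; apply: eq_bigr => x xJ; rewrite C'J.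
rewrite /C' eqxx setIA => ->; first by rewrite (indep_of_xiM S)// muleA.
by move=> x /=; rewrite !inE => /orP[/eqP -> //|/JS[]].
Qed.

Lemma indep_of_bigcup S (F : nat -> set T) : trivIset setT F ->
  (forall k, indep_of S (F k)) -> indep_of S (\bigcup_k F k).
Proof.
move=> tF hF; have mF k : measurable (F k) by have [] := hF k.
split => [|J B JS]; first exact: bigcup_measurable.
have mI k : measurable (F k `&` \bigcap_(i in [set` J]) (xi i @^-1` B i)).
  by apply: measurableI => //; exact: measurable_bigcap_xi.
rewrite setI_bigcupl !measure_semi_bigcup//;
  try by [exact: bigcup_measurable | exact: trivIset_setIr].
rewrite [RHS]muleC -nneseriesZl_ereal//; last by apply: prode_ge0.
by apply: eq_eseriesr => k _; rewrite [RHS]muleC; have [_] := hF k; apply.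
Qed.

(** The individuals that follow, in lexicographic order, the first [j] members
    of generation [n]. *)
Definition later n j : set (nat * nat) :=
  [set x | (n < x.1)%N || ((x.1 == n) && (j <= x.2)%N)].

Lemma indep_of_litter n j k A : indep_of (later n 0) A ->
  indep_of (later n j) (A `&` [set w | (\sum_(i < j) xi (n, i : nat) w)%N = k]).
Proof.
move=> hA; elim: j k => [|j IH] k.
  case: k => [|k].
    rewrite (_ : _ `&` _ = A)//; apply/seteqP; split => w; first by case.
    by move=> Aw; split => //=; rewrite big_ord0.
  rewrite (_ : _ `&` _ = set0); first exact: indep_of0.
  by apply/seteqP; split => w //= [_]; rewrite big_ord0.
pose F v := (A `&` [set w | (\sum_(i < j) xi (n, i : nat) w)%N = v]) `&`
  xi (n, j) @^-1` [set x | (v + x)%N = k].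
rewrite (_ : _ `&` _ = \bigcup_v F v); last first.
  apply/seteqP; split => w /=.
    move=> [Aw]; rewrite big_ord_recr /= => Sk.
    by exists (\sum_(i < j) xi (n, i : nat) w)%N.
  by move=> [v _ [[Aw /= sv] /= vk]]; split => //; rewrite big_ord_recr /= sv.
apply: indep_of_bigcup => [|v].
  by move=> v v' _ _ [w [[[_ /= <-] _] [[_ /= <-] _]]].
apply: (@indep_ofS (later n j `\ (n, j))); last first.
  by apply: indep_of_xi; [exact: IH | rewrite /later /= eqxx leqnn orbT].
move=> [x y] /= /orP[nx|/andP[/= /eqP -> jy]]; split; rewrite /later /= ?nx//.
- by move=> [xn _]; move: nx; rewrite xn ltnn.
- by rewrite eqxx (ltnW jy) orbT.
- by move=> [yj]; move: jy; rewrite yj ltnn.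
Qed.

(** A substitute for the natural filtration that is stable under intersections and
    under all unions; since the [Z k] are integer valued, measurability of these
    events is a consequence ([measurable_determined]). *)
Definition determined_by n L : Prop :=
  forall w w', (forall k, (k <= n)%N -> Z k w = Z k w') -> L w -> L w'.

Lemma determined_by_preimage n k (B : set nat) : (k <= n)%N ->
  determined_by n (Z k @^-1` B).
Proof. by move=> kn w w' /(_ k kn) /= ->. Qed.

Lemma determined_byI n L L' : determined_by n L -> determined_by n L' ->
  determined_by n (L `&` L').
Proof. by move=> hL hL' w w' ww' [Lw L'w]; split; [exact: hL Lw | exact: hL' L'w]. Qed.

Lemma determined_byS n m L : (n <= m)%N -> determined_by n L -> determined_by m L.
Proof.
by move=> nm hL w w' ww' Lw; apply: hL Lw => k kn; apply: ww'; exact: leq_trans nm.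
Qed.

Lemma natural_filtration_determined n L :
  natural_filtration Z n L -> determined_by n L.
Proof.
apply: (smallest_sub (X := determined_by n)).
- split => [//|A hA|F hF].
  + move=> w w' ww' [_ Aw]; split => // Aw'; apply: Aw; apply: hA Aw' => k kn.
    by rewrite ww'.
  + by move=> w w' ww' [k _ Fk]; exists k => //; exact: hF Fk.
- by move=> _ [k kn [B ->]]; exact: determined_by_preimage.
Qed.

(** By induction on [n]: cutting an event determined by [Z_0, ..., Z_(n+1)] along
    the values of [Z_n] and [Z_(n+1)] leaves an event determined by
    [Z_0, ..., Z_n] and a condition on the litters of generation [n]. *)
Lemma determined_by_indep n L : determined_by n L -> indep_of (later n 0) L.
Proof.
elim: n L => [|n IH] L hL.
  have [[w Lw]|L0] := pselect (exists w, L w).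
    rewrite (_ : L = setT); first exact: indep_ofT.
    by apply/seteqP; split => // w' _; apply: hL Lw => -[|//] _; rewrite !Z0.
  rewrite (_ : L = set0); first exact: indep_of0.
  by apply/seteqP; split => // w Lw; apply: L0; exists w.
pose past k := [set w | exists w',
  [/\ L w', (forall i, (i <= n)%N -> Z i w' = Z i w) & Z n.+1 w' = k]].
have past_det k j : determined_by n (past k `&` Z n @^-1` [set j]).
  apply: determined_byI; last exact: determined_by_preimage.
  move=> w w' ww' [v [Lv vw vk]]; exists v; split => // i ile.
  by rewrite vw// ww'.
pose F k j := (past k `&` Z n @^-1` [set j]) `&`
  [set w | (\sum_(i < j) xi (n, i : nat) w)%N = k].
rewrite (_ : L = \bigcup_k \bigcup_j F k j); last first.
  apply/seteqP; split => w.
    move=> Lw; exists (Z n.+1 w) => //; exists (Z n w) => //.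
    by split => /=; [split => //; exists w | rewrite -ZS].
  move=> [k _ [j _ [[[v [Lv vw vk]] /= Zj] Sk]]]; apply: hL Lv => i.
  rewrite leq_eqVlt ltnS => /orP[/eqP ->|/vw//].
  by rewrite vk ZS Zj Sk.
apply: indep_of_bigcup => [k k' _ _|k].
  move=> [w [[j _ [[_ /= <-] /= <-]] [j' _ [[_ /= <-] /= <-]]]].
  by [].
apply: indep_of_bigcup => [j j' _ _|j].
  by move=> [w [[[_ /= <-] _] [[_ /= <-] _]]].
apply: (@indep_ofS (later n j)).
  by move=> [x y]; rewrite /later /= leq0n andbT => /orP[/ltnW->//|/eqP ->]; rewrite ltnSn.
exact/indep_of_litter/IH/past_det.
Qed.

Lemma measurable_determined n L : determined_by n L -> measurable L.
Proof. by move=> /determined_by_indep[]. Qed.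

Lemma measurable_nat_comp (g : T -> nat) (h : nat -> \bar R) A :
  measurable_fun setT g -> measurable_fun A (fun w => h (g w)).
Proof.
move=> mg mA B _; apply: measurableI => //.
by rewrite (_ : _ @^-1` B = g @^-1` (h @^-1` B))// -[X in measurable X]setTI; exact: mg.
Qed.

Lemma measurable_Z n : measurable_fun setT (Z n).
Proof.
move=> _ B _; rewrite setTI; apply: (@measurable_determined n).
exact: determined_by_preimage.
Qed.

Lemma measurable_litter n j :
  measurable_fun setT (fun w => \sum_(i < j) xi (n, i : nat) w)%N.
Proof.
elim: j => [|j IH]; first by under eq_fun do rewrite big_ord0; exact: measurable_cst.
under eq_fun do rewrite big_ord_recr /=.
exact: measurable_fun_addn.
Qed.

Lemma trivIset_preimage1_setI (A : set T) (g : T -> nat) :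
  trivIset setT (fun k => A `&` g @^-1` [set k]).
Proof. by move=> k k' _ _ [w [[_ /= <-] [_ /= <-]]]. Qed.

Lemma setI_bigcup_preimage1 (A : set T) (g : T -> nat) :
  A = \bigcup_k (A `&` g @^-1` [set k]).
Proof. by apply/seteqP; split => [w Aw|w [k _ []]//]; exists (g w). Qed.

Let q_ge0 k : (0 <= q k)%R.
Proof. by rewrite -lee_fin -(xi_law (0%N, 0%N)) measure_ge0. Qed.

Lemma integral_litter n j A (h : nat -> \bar R) : (forall k, 0 <= h k) ->
  indep_of [set x | x.1 = n /\ (x.2 < j)%N] A ->
  \int[P]_(w in A) h (\sum_(i < j) xi (n, i : nat) w)%N = P A * litter_mean q j h.
Proof.
elim: j A h => [|j IH] A h h0 hA; have [mA _] := hA.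
  under eq_integral do rewrite big_ord0.
  by rewrite integral_cst// muleC.
rewrite {1}(setI_bigcup_preimage1 A (xi (n, j))) ge0_integral_bigcup//=; first last.
- exact: trivIset_preimage1_setI.
- exact/measurable_nat_comp/measurable_litter.
- by move=> k; apply: measurableI => //; exact: measurable_xi_preimage.
rewrite -nneseriesZl_ereal//; last first.
  by move=> k; apply: mule_ge0; [rewrite lee_fin | exact: litter_mean_ge0].
apply: eq_eseriesr => k _.
transitivity (\int[P]_(w in A `&` xi (n, j) @^-1` [set k])
    h (k + \sum_(i < j) xi (n, i : nat) w)%N).
  apply: eq_integral => w; rewrite inE => -[_ /= wk].
  by rewrite big_ord_recr /= wk addnC.
have Snj : [set x : nat * nat | x.1 = n /\ (x.2 < j.+1)%N] (n, j) by split => /=.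
rewrite (IH _ (fun x => h (k + x)%N))//.
  by rewrite (indep_of_xiM _ _ _ _ hA)// xi_law muleA.
apply: indep_ofS (indep_of_xi _ _ _ _ hA Snj) => -[x y] /= [-> yj].
by split; [split => //; exact: ltnW | move=> [yE]; move: yj; rewrite yE ltnn].
Qed.

Lemma integral_next_generation n A (h : nat -> \bar R) : (forall k, 0 <= h k) ->
  determined_by n A ->
  \int[P]_(w in A) h (Z n.+1 w) = \int[P]_(w in A) litter_mean q (Z n w) h.
Proof.
move=> h0 hA.
have hAk k : determined_by n (A `&` Z n @^-1` [set k]).
  by apply: determined_byI => //; exact: determined_by_preimage.
have mAk k : measurable (A `&` Z n @^-1` [set k]) by exact: measurable_determined (hAk k).
rewrite (setI_bigcup_preimage1 A (Z n)) !ge0_integral_bigcup//=; first last.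
- exact: trivIset_preimage1_setI.
- exact/measurable_nat_comp/measurable_Z.
- exact: trivIset_preimage1_setI.
- by move=> w _; exact: litter_mean_ge0.
- exact/(measurable_nat_comp _ (fun k => litter_mean q k h))/measurable_Z.
apply: eq_eseriesr => k _.
transitivity (\int[P]_(w in A `&` Z n @^-1` [set k])
    h (\sum_(i < k) xi (n, i : nat) w)%N).
  by apply: eq_integral => w; rewrite inE => -[_ /= wk]; rewrite ZS wk.
rewrite integral_litter//; last first.
  apply: indep_ofS (determined_by_indep _ _ (hAk k)) => -[x y] /= [-> _].
  by rewrite /later /= eqxx orbT.
transitivity (\int[P]_(w in A `&` Z n @^-1` [set k]) litter_mean q k h).
  by rewrite integral_cst// muleC.
by apply: eq_integral => w; rewrite inE => -[_ /= ->].
Qed.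

(** The Markov property at time [n], by absorbing the last generation into the
    function [h]. *)
Lemma integral_gw n m A (h : nat -> \bar R) : (forall k, 0 <= h k) ->
  determined_by n A ->
  \int[P]_(w in A) h (Z (m + n)%N w) = \int[P]_(w in A) gw_mean q m h (Z n w).
Proof.
move=> h0 hA; elim: m h h0 => [//|m IH] h h0.
rewrite addSn integral_next_generation//; last first.
  by apply: determined_byS hA; exact: leq_addl.
rewrite (IH (fun k => litter_mean q k h)) => [|k]; last exact: litter_mean_ge0.
by rewrite -[m.+1]addn1 gw_meanDn.
Qed.

Lemma integral_gwT n (h : nat -> \bar R) : (forall k, 0 <= h k) ->
  \int[P]_w h (Z n w) = gw_mean q n h 1.
Proof.
move=> h0; rewrite -[n in LHS]addn0 integral_gw//.
under eq_integral do rewrite Z0.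
by rewrite integral_cst//= probability_setT mule1.
Qed.

(** * The conditioned weights *)

Section ConditionedWeight.
Context (a p b0 : nat) (s : R).
Hypothesis q_sum : \sum_(0 <= k <oo) (q k)%:E = 1.
Hypothesis q_min : forall k, (0 < q k)%R -> (a <= k)%N.
Hypothesis q_a : (0 < q a)%R.
Hypothesis a_gt0 : (0 < a)%N.
Hypothesis s01 : (0 < s < 1)%R.
Hypothesis b0_gt1 : (1 < b0)%N.
Hypothesis q_b0 : (0 < q b0)%R.

Lemma prob_slowest_growth n :
  P (Z n @^-1` [set (a ^ n)%N]) = (q a ^+ (\sum_(i < n) a ^ i)%N)%:E.
Proof.
pose h k : \bar R := ((k == a ^ n)%N%:R)%:E.
have h0 k : 0 <= h k by rewrite lee_fin.
have hs k : (a ^ n * 1 < k)%N -> h k = 0.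
  by rewrite muln1 /h; case: ltngtP.
have := gw_mean_min q a q_ge0 q_sum q_min n h 1 h0 hs a_gt0.
rewrite muln1 mul1n /h eqxx mule1 => <-; rewrite -integral_gwT//.
have mB : measurable (Z n @^-1` [set (a ^ n)%N]).
  by apply: (@measurable_determined n); exact: determined_by_preimage.
rewrite -[X in P X]setIT -integral_indic//; apply: eq_integral => w _.
rewrite indicE; congr ((_ : bool)%:R%:E).
by apply/idP/eqP; rewrite inE.
Qed.

(** On an event [L] of the past, the weight concentrates on the smallest possible
    value [a ^ n] of [Z_n]: the values below have probability [0], and those
    above contribute a geometrically small proportion. *)
Lemma conditioned_weight_bounds : exists C rho : R,
  [/\ (0 <= C)%R, (0 <= rho < 1)%R &
    forall n L m, determined_by n L -> (p <= m)%N ->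
    P (L `&` Z n @^-1` [set (a ^ n)%N]) * gw_mean q m (bin_weight s p) (a ^ n)%N
      <= \int[P]_(w in L) bin_weight s p (Z (m + n)%N w) <=
    P (L `&` Z n @^-1` [set (a ^ n)%N]) * gw_mean q m (bin_weight s p) (a ^ n)%N
      + (C * rho ^+ m)%:E * gw_mean q m (bin_weight s p) (a ^ n)%N].
Proof.
have [C [rho [C0 rho01 ratio]]] := gw_bin_weight_ratio q a q_ge0 q_sum q_min
  p s b0 a_gt0 s01 b0_gt1 q_b0.
exists C, rho; split => // n L m hL pm.
set u := gw_mean q m _ _; set x := P _.
have bw0 := bin_weight_ge0 s s01 p.
pose g := gw_mean q m (bin_weight s p).
have g0 k : 0 <= g k by exact: gw_mean_ge0.
pose B := Z n @^-1` [set (a ^ n)%N].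
have hB : determined_by n B by exact: determined_by_preimage.
have mL := measurable_determined _ _ hL.
have mB := measurable_determined _ _ hB.
have mg A : measurable_fun A (fun w => g (Z n w)).
  exact/measurable_nat_comp/measurable_Z.
have -> : \int[P]_(w in L) bin_weight s p (Z (m + n)%N w) =
    x * u + \int[P]_(w in L `\` B) g (Z n w).
  rewrite integral_gw// -[in LHS](setUIDK L B) ge0_integral_setU//; first last.
  - by apply/disj_setPS => w [[_ Bw] [_ /(_ Bw)]].
  - exact: measurableD.
  - exact: measurableI.
  congr (_ + _); transitivity (\int[P]_(w in L `&` B) u).
    by apply: eq_integral => w; rewrite inE => -[_ /= ->].
  by rewrite integral_cst 1?muleC//; exact: measurableI.
apply/andP; split; first by rewrite leeDl// integral_ge0.
rewrite leeD2l//.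
(* With the value [a ^ n] erased, the integral may be extended to the whole space,
   where it is a mean for the chain started from [1]; that mean only sees the
   integers from [a ^ n] on. *)
pose f k := if k == (a ^ n)%N then 0 else g k.
have f0 k : 0 <= f k by rewrite /f; case: ifP.
have c0 : 0 <= (C * rho ^+ m)%:E * u.
  case/andP: rho01 => rho0 _; apply: mule_ge0; last exact: g0.
  by rewrite lee_fin mulr_ge0// exprn_ge0.
apply: (@le_trans _ _ (\int[P]_w f (Z n w))).
  rewrite (_ : \int[P]_(w in _) _ = \int[P]_(w in L `\` B) f (Z n w)); last first.
    by apply: eq_integral => w; rewrite inE /f /B /= => -[_ /= /eqP/negbTE ->].
  apply: ge0_subset_integral => //; first exact: measurableD.
  exact/measurable_nat_comp/measurable_Z.
rewrite integral_gwT// -[leRHS](gw_mean_cst q q_ge0 q_sum n _ 1 c0).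
apply: (le_gw_mean q a) => // k; rewrite muln1 leq_eqVlt /f.
by case: eqVneq => [_ _ //|/= _ ank]; apply: ratio => //; rewrite expn_gt0 a_gt0.
Qed.

(** Both the numerator and the denominator of the ratio are asymptotically
    proportional to the weight of the population started from [a ^ n]. *)
Lemma cvg_conditioned_ratio n L : determined_by n L ->
  (\int[P]_(w in L) bin_weight s p (Z (m + n)%N w) /
   \int[P]_w bin_weight s p (Z (m + n)%N w)) @[m --> \oo] -->
  (q a ^- (\sum_(i < n) a ^ i)%N)%:E * P (L `&` Z n @^-1` [set (a ^ n)%N]).
Proof.
move=> hL; have [C [rho [C0 /andP[rho0 rho1] bnd]]] := conditioned_weight_bounds.
set B := Z n @^-1` [set (a ^ n)%N]; set y : R := (q a ^+ (\sum_(i < n) a ^ i)%N)%R.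
have an0 : (0 < a ^ n)%N by rewrite expn_gt0 a_gt0.
have y0 : (0 < y)%R by rewrite exprn_gt0.
have mL := measurable_determined _ _ hL.
have mB : measurable B.
  by apply: (@measurable_determined n); exact: determined_by_preimage.
have xE : P (L `&` B) = (fine (P (L `&` B)))%:E.
  by rewrite fineK// fin_num_measure//; exact: measurableI.
set x := fine (P (L `&` B)) in xE *.
have x0 : (0 <= x)%R by rewrite -lee_fin -xE.
rewrite xE -EFinM; pose e m : R := (C * rho ^+ m)%R.
have e0 m : (0 <= e m)%R by rewrite mulr_ge0// exprn_ge0.
have cvg_e : e m @[m --> \oo] --> (0 : R)%R.
  rewrite -[X in _ --> X](mulr0 C); apply: cvgMr.
  by apply: cvg_expr; rewrite ger0_norm.
apply: (@squeeze_cvge _ _ _ _ (fun m => (x / (y + e m))%:E) _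
                              (fun m => ((x + e m) / y)%:E)).
- near=> m.
  have pm : (p <= m)%N by near: m; exact: nbhs_infty_ge.
  have := bnd n setT m (fun _ _ _ _ => I) pm; have := bnd n L m hL pm.
  rewrite /= setTI -/B prob_slowest_growth -/y xE.
  have uE := gw_bin_weight_fin q a q_ge0 q_sum q_min s b0 a_gt0 s01 b0_gt1 q_b0
    p m _ an0.
  have := gw_bin_weight_gt0 q q_ge0 p s b0 s01 b0_gt1 q_b0 m _ pm an0.
  rewrite -(fineK uE); set u := fine _; rewrite lte_fin => u0.
  set N := integral _ L _; set D := integral _ setT _.
  rewrite -/(e m) -!EFinM -!EFinD => /andP[N1 N2] /andP[D1 D2].
  have [nu nuE] : exists nu : R, N = nu%:E.
    exists (fine N); rewrite fineK// fin_numElt.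
    by rewrite (lt_le_trans (ltNyr _) N1) (le_lt_trans N2 (ltry _)).
  have [de deE] : exists de : R, D = de%:E.
    exists (fine D); rewrite fineK// fin_numElt.
    by rewrite (lt_le_trans (ltNyr _) D1) (le_lt_trans D2 (ltry _)).
  move: N1 N2 D1 D2; rewrite nuE deE !lee_fin => N1 N2 D1 D2.
  have de0 : (0 < de)%R by apply: lt_le_trans D1; rewrite mulr_gt0.
  rewrite inver gt_eqF// -EFinM !lee_fin; apply/andP; split.
    rewrite ler_pdivrMr ?ltr_wpDr// mulrAC ler_pdivlMr//.
    apply: (@le_trans _ _ (x * ((y + e m) * u))%R).
      by rewrite ler_wpM2l// mulrDl.
    by rewrite mulrCA mulrC ler_wpM2r ?addr_ge0// ltW.
  rewrite ler_pdivrMr// mulrAC ler_pdivlMr//.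
  apply: (@le_trans _ _ ((x + e m) * u * y)%R).
    by rewrite ler_wpM2r ?(ltW y0)// mulrDl.
  by rewrite -mulrA ler_wpM2l ?addr_ge0// mulrC.
- apply: cvg_EFin; first by near=> m.
  rewrite [X in _ --> X]mulrC; apply: cvgMr; apply: cvgV; first exact: lt0r_neq0.
  by rewrite -[X in _ --> X]addr0; apply: cvgD => //; exact: cvg_cst.
- apply: cvg_EFin; first by near=> m.
  rewrite [X in _ --> X]mulrC; apply: cvgMl.
  by rewrite -[X in _ --> X]addr0; apply: cvgD => //; exact: cvg_cst.
Unshelve. all: by end_near.
Qed.

End ConditionedWeight.

End MarkovProperty.

(** * From the offspring law and the penalty to the abstract weights *)

Section Reductions.
Context {R : realType}.
Implicit Types (q : R^nat).

Lemma probability_weights_sum q : probability_weights q ->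
  (\sum_(0 <= k <oo) (q k)%:E = 1)%E.
Proof.
move=> [q0 q1]; apply/cvg_lim => //.
under eq_fun do rewrite sumEFin.
by apply: cvg_EFin q1; exact: nearW.
Qed.

(** A law on [{0, 1}] has mean at most [1]. *)
Lemma supercritical_two_children q : probability_weights q ->
  (1 < offspring_mean q)%E -> exists2 b, (1 < b)%N & 0 < q b.
Proof.
move=> hq; have [q0 _] := hq; apply: contraPP => nex; apply/negP; rewrite -leNgt.
rewrite -(probability_weights_sum q hq) /offspring_mean.
apply: lee_nneseries => [k _ _|k _]; first by rewrite lee_fin mulr_ge0.
rewrite lee_fin; have [qk|] := ltP 0 (q k); last first.
  by move=> qk; have -> : q k = 0; [apply/le_anti; rewrite qk q0 | rewrite mulr0].
have k1 : (k <= 1)%N by rewrite leqNgt; apply/negP => k1; apply: nex; exists k.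
by rewrite ler_piMl// lern1.
Qed.

Lemma hilbert_poly_nat p z : (hilbert_poly p).[z%:R] = 'C(z, p)%:R :> R.
Proof.
rewrite /hilbert_poly hornerZ horner_prod.
have p0 : p`!%:R != 0 :> R by rewrite pnatr_eq0 -lt0n fact_gt0.
apply: (mulfI p0); rewrite mulVKf// -natrM mulnC bin_ffact ffact_prod.
under eq_bigr do rewrite hornerXsubC.
have [pz|zp] := leqP p z.
  rewrite natr_prod; apply: eq_bigr => i _; rewrite natrB//.
  exact: leq_trans (ltnW (ltn_ord i)) pz.
rewrite (bigD1 (Ordinal zp))//= subrr mul0r.
by rewrite (bigD1 (Ordinal zp))//= subnn mul0n.
Qed.

Lemma penalty_bin_weight p (s : R) z : (penalty p s z)%:E = bin_weight s p z.
Proof. by rewrite /penalty hilbert_poly_nat. Qed.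

Lemma integral_mul_indic {d : measure_display} {T : measurableType d}
    (P : probability T R) (L : set T) (f : T -> R) :
  (\int[P]_w (f w * \1_L w)%:E = \int[P]_(w in L) (f w)%:E)%E.
Proof.
rewrite [RHS]integral_mkcond; apply: eq_integral => w _.
by rewrite patchE indicE; case: ifP => _; rewrite ?mulr1 ?mulr0.
Qed.

Lemma expectation_indicI {d : measure_display} {T : measurableType d}
    (P : probability T R) (A L : set T) (c : R) : 0 <= c ->
  measurable A -> measurable L ->
  ('E_P[(fun w => c * \1_A w * \1_L w)%R] = c%:E * P (L `&` A))%E.
Proof.
move=> c0 mA mL; rewrite unlock integral_mul_indic.
rewrite (integralZl_indic mL (fun=> A) c)//; last by rewrite ltNge c0.
by rewrite integral_indic// setIC.
Qed.

End Reductions.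

Theorem theorem3p5 (R : realType) (d : measure_display) (T : measurableType d)
    (P : probability T R) (q : R^nat) (Z : nat -> T -> nat) (p a : nat)
    (hq : probability_weights q)
    (hmu_fin : (offspring_mean q < +oo)%E)
    (hZ : galton_watson P q Z)
    (hmu : (1 < offspring_mean q)%E)
    (hp : (moment q p < +oo)%E)
    (ha : is_min_offspring q a)
    (ha0 : (0 < a)%N)
    (s : R) (hs : 0 < s < 1)
    (n : nat) (L : set T) (hL : natural_filtration Z n L) :
  ('E_P[fun w => (penalty p s (Z (m + n)%N w) * \1_L w)%R]
     / 'E_P[fun w => penalty p s (Z (m + n)%N w)])%E @[m --> \oo] -->
  if a == 1%N then
    ('E_P[fun w => (q 1%N ^- n * \1_[set w' | Z n w' = 1%N] w * \1_L w)%R])%E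
  else
    ('E_P[fun w => (q a ^- ((a ^ n - 1) %/ (a - 1))%N
                    * \1_[set w' | Z n w' = (a ^ n)%N] w * \1_L w)%R])%E.
Proof.
have [q_ge0 _] := hq; have q_sum := probability_weights_sum q hq.
have [b0 b0_gt1 q_b0] := supercritical_two_children q hq hmu.
have [q_a q_min] := ha.
have [xi [xi_indep xi_law Z0 ZS]] := hZ.
have hL' := natural_filtration_determined Z n L hL.
have mdet := measurable_determined P Z xi xi_indep Z0 ZS n.
have mL : measurable L by exact: mdet.
have mB : measurable (Z n @^-1` [set (a ^ n)%N]).
  by apply: mdet; exact: determined_by_preimage.
rewrite [X in _ --> X](_ : _ =
    (q a ^- (\sum_(i < n) a ^ i)%N)%:E * P (L `&` Z n @^-1` [set (a ^ n)%N]))%E.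
  have -> : (fun m => 'E_P[fun w => (penalty p s (Z (m + n)%N w) * \1_L w)%R] /
      'E_P[fun w => penalty p s (Z (m + n)%N w)])%E =
    (fun m => \int[P]_(w in L) bin_weight s p (Z (m + n)%N w) /
      \int[P]_w bin_weight s p (Z (m + n)%N w))%E.
    apply/funext => m; rewrite unlock integral_mul_indic.
    by congr (_ / _)%E; apply: eq_integral => w _; rewrite penalty_bin_weight.
  exact: (cvg_conditioned_ratio P q Z xi xi_indep xi_law Z0 ZS a p b0 s q_sum
    q_min q_a ha0 hs b0_gt1 q_b0 n L hL').
case: eqVneq => [a1|a_neq1].
  rewrite -expectation_indicI ?invr_ge0 ?exprn_ge0//.
  rewrite a1 exp1n; congr ('E_P[_])%E; apply/funext => w.
  by congr (_ ^- _ * _ * _); under eq_bigr do rewrite exp1n; rewrite sum_nat_const card_ord muln1.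
rewrite -expectation_indicI ?invr_ge0 ?exprn_ge0//.
congr ('E_P[_])%E; apply/funext => w; congr (_ ^- _ * _ * _).
rewrite !subn1 predn_exp mulKn// -subn1 subn_gt0.
by rewrite ltn_neqAle eq_sym a_neq1.
Qed.
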